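(* Let $p$ be a prime and $m$ a positive integer, and suppose that $p>3$ or $m>2$. Let $d_A$ be the minimum distance of an extended maximal affine-invariant code of length $p^m$ over $\mathbb{F}_p$. Then there exists a pure quantum code with parameters $$[[p^m,\ p^m-2-2m,\ d_Q]]_p \quad\text{with}\quad m+2\ \ge\ d_Q = d_A .$$
   Context: Classical codes. Let $n=p^m-1$ and let $\beta$ be a fixed primitive $n$-th root of unity in $G=\mathbb{F}_{p^m}$. A cyclic code $C$ of length $n$ over $\mathbb{F}_p$ is an ideal of $\mathbb{F}_p[x]/(x^n-1)$ generated by a polynomial $g(x)$ dividing $x^n-1$; its defining set is $T=\{0\le i\le n-1 : g(\beta^i)=0\}$, a union of cyclotomic classes $Cl(j)=\{jp^l \bmod n : l\in\mathbb{Z}\}$. $C$ is a maximal cyclic code if $T$ consists of exactly one cyclotomic class. The extended code of $C$ is $\hat{C}=\{(x_0,x_1,\dots,x_n) : (x_1,\dots,x_n)\in C,\ x_0=-\sum_{i=1}^n x_i\}$, of length $p^m$, with coordinates labelled by the elements of $G$: $x_0$ is labelled by $0$, and the coordinate of $C$ that is the coefficient of $x^i$ is labelled by $\beta^i$. $\hat{C}$ is affine-invariant if it is invariant under all coordinate permutations induced by the maps $X\mapsto aX+b$ of $G$, $a\in G\setminus\{0\}$, $b\in G$. An extended maximal affine-invariant code is an affine-invariant code of the form $\hat{C}$ with $C$ a maximal cyclic code. Quantum codes. Let $\{|x\rangle : x\in\mathbb{F}_p\}$ be an orthonormal basis of $\mathbb{C}^p$ and $\omega=e^{2\pi i/p}$.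 For $a,b\in\mathbb{F}_p^N$ let $E_{a,b}$ be the operator on $(\mathbb{C}^p)^{\otimes N}$ equal to $\bigotimes_i X(a_i)Z(b_i)$, where $X(a)|x\rangle=|x+a\rangle$ and $Z(b)|x\rangle=\omega^{bx}|x\rangle$; its weight is the number of $i$ with $(a_i,b_i)\ne(0,0)$. A quantum code with parameters $[[N,K,d]]_p$ is a subspace of $(\mathbb{C}^p)^{\otimes N}$ of dimension $p^K$, with orthogonal projector $P$, such that $d$ is the largest integer for which every $E_{a,b}$ of weight less than $d$ satisfies $PE_{a,b}P=cP$ for some scalar $c$ (depending on $a,b$). For $K=0$ the usual convention is to require instead that $d$ be the largest integer such that $PE_{a,b}P=0$ for all $E_{a,b}$ of weight between $1$ and $d-1$. The code is pure if $PE_{a,b}P=0$ for all $E_{a,b}$ of weight between $1$ and $d-1$. *)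

(* Defs.v *)
From HB Require Import structures.
From mathcomp Require Import all_boot all_order all_algebra.
From mathcomp Require Import qpoly complex.
From mathcomp Require Import boolp classical_sets reals trigo.

Set Implicit Arguments.
Unset Strict Implicit.
Unset Printing Implicit Defensive.

Import Order.TTheory GRing.Theory Num.Theory.
Local Open Scope classical_set_scope.
Local Open Scope ring_scope.

Section ClassicalCodes.

Variables (p n : nat) (G : finFieldType) (beta : G).

(* When G has characteristic p, this is the inclusion of the prime field. *)
Definition prime_field_incl (c : 'F_p) : G := (c : nat)%:R.

Local Notation qring := {poly %/ ('X^n - 1 : {poly 'F_p})}.

Definition generated_ideal (g : {poly 'F_p}) : set qring :=
  [set c | exists h : qring, c = h * in_qpoly ('X^n - 1) g].

Definition defining_set (g : {poly 'F_p}) : set nat :=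
  [set i | (i < n)%N /\ (map_poly prime_field_incl g).[beta ^+ i] = 0].

(* The exponent l of p ranges over all integers: the second disjunct says
   i = j * p ^ (- l) modulo n, p being invertible modulo n = p ^ m - 1. *)
Definition cyclotomic_class (j : nat) : set nat :=
  [set i | (i < n)%N /\
     exists l : nat, i = j * p ^ l %[mod n] \/ i * p ^ l = j %[mod n]].

Definition maximal_cyclic (C : set qring) : Prop :=
  exists g : {poly 'F_p},
    [/\ g %| 'X^n - 1,
        C = generated_ideal g
      & exists2 j : nat, (j < n)%N & defining_set g = cyclotomic_class j].

(* A word of length #|G| is a function on the labels.  If beta is a primitive
   n-th root of unity and #|G| = n + 1, the labels 0 and beta ^+ i (i < n)
   exhaust G without repetition, so c determines v. *)
Definition extended_code (C : set qring) : set {ffun G -> 'F_p} :=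
  [set v | exists c : qring,
     [/\ C c, v 0 = - \sum_(i < n) c`_i
       & forall i : 'I_n, v (beta ^+ i) = c`_i]].

Definition affine_invariant (A : set {ffun G -> 'F_p}) : Prop :=
  forall (a b : G), a != 0 ->
  forall v : {ffun G -> 'F_p}, A [ffun X => v (a * X + b)] <-> A v.

Definition extended_maximal_affine_invariant (A : set {ffun G -> 'F_p}) : Prop :=
  affine_invariant A /\ exists2 C, maximal_cyclic C & A = extended_code C.

End ClassicalCodes.

Section MinimumDistance.

Variables (I : finType) (F : eqType).

Definition hamming_dist (u v : {ffun I -> F}) : nat := #|[pred i | u i != v i]|.

Definition min_distance (A : set {ffun I -> F}) (d : nat) : Prop :=
  (exists u v, [/\ A u, A v, u != v & hamming_dist u v = d]) /\
  (forall u v, A u -> A v -> u != v -> (d <= hamming_dist u v)%N).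

End MinimumDistance.

(* (C^p)^{\otimes N}, by coordinates in the product basis |x_0> ... |x_{N-1}>. *)
Notation qudit_space R p N := {ffun {ffun 'I_N -> 'F_p} -> (R[i])^o}.

Section QuantumCodes.

Variables (R : realType) (p N : nat).

Local Notation C := R[i].
Local Notation qudits := (qudit_space R p N).

(* 'F_p is by definition the type of ordinals below this number, which equals p
   for p prime; it serves as the size of matrices indexed by 'F_p. *)
Local Notation q := (Zp_trunc (pdiv p)).+2.

Definition hdot (u v : qudits) : C := \sum_x (u x)^* * v x.

Definition omega : C :=
  Complex (cos (2 * pi / p%:R)) (sin (2 * pi / p%:R)).

(* Matrices act on columns: the (y, x) entry is <y| M |x>. *)
Definition shift_mx (a : 'F_p) : 'M[C]_q :=
  \matrix_(y, x) ((y : 'F_p) == (x : 'F_p) + a)%:R.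

Definition clock_mx (b : 'F_p) : 'M[C]_q :=
  \matrix_(y, x) if y == x then omega ^+ ((b * (x : 'F_p))%R : 'F_p) else 0.

Definition tensor_fun (M : 'I_N -> 'M[C]_q) (u : qudits) : qudits :=
  [ffun y : {ffun 'I_N -> 'F_p} =>
     \sum_(x : {ffun 'I_N -> 'F_p}) (\prod_(i < N) M i (y i) (x i)) * u x].

Fact tensor_fun_is_linear M : linear (tensor_fun M).
Proof.
move=> k u v; apply/ffunP => y; rewrite !ffunE scaler_sumr -big_split /=.
apply: eq_bigr => x _; rewrite !ffunE mulrDr; congr (_ + _).
by rewrite /GRing.scale /= mulrCA.
Qed.

HB.instance Definition _ M :=
  GRing.isLinear.Build C qudits qudits *:%R (tensor_fun M)
    (tensor_fun_is_linear M).

Definition tensor_op (M : 'I_N -> 'M[C]_q) : 'End(qudits) :=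
  linfun (tensor_fun M).

Definition error_op (a b : {ffun 'I_N -> 'F_p}) : 'End(qudits) :=
  tensor_op (fun i => shift_mx (a i) *m clock_mx (b i)).

Definition error_weight (a b : {ffun 'I_N -> 'F_p}) : nat :=
  #|[pred i | (a i, b i) != (0, 0)]|.

Definition orthogonal_projector (V : {vspace qudits}) (P : 'End(qudits)) : Prop :=
  [/\ limg P = V, (P \o P)%VF = P
    & forall u v, hdot (P u) v = hdot u (P v)].

Definition detects_below (P : 'End(qudits)) (d : nat) : Prop :=
  forall a b, (error_weight a b < d)%N ->
  exists c : C, (P \o error_op a b \o P)%VF = c *: P.

Definition purely_detects_below (P : 'End(qudits)) (d : nat) : Prop :=
  forall a b, (0 < error_weight a b < d)%N ->
  (P \o error_op a b \o P)%VF = 0.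

Definition is_largest (Q : nat -> Prop) (d : nat) : Prop :=
  Q d /\ forall d', Q d' -> (d' <= d)%N.

(* The parameters [[N, K, d]]_p of the code V with orthogonal projector P.  When
   K = 0, P has rank 1 and P E P is always a multiple of P, so the convention is
   to define d by purity instead. *)
Definition quantum_code (V : {vspace qudits}) (P : 'End(qudits)) (K d : nat)
    : Prop :=
  [/\ \dim V = (p ^ K)%N,
      orthogonal_projector V P
    & is_largest
        (if K == 0%N then purely_detects_below P else detects_below P) d].

Definition pure_code (P : 'End(qudits)) (d : nat) : Prop := purely_detects_below P d.

End QuantumCodes.

(* Main.v *)
(* Affine invariance pins down the code.  Let Cl(j) be the class of zeros; j is
   nonzero, since otherwise all words vanish at 0, hence everywhere.  Write
   j = p^l u with u prime to p, so that X^u is also a zero.  Invariance under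
   translations gives sum_X v(X) (X - b)^u = 0 for all b in G; as a polynomial
   in b this has degree less than n, so its coefficient of b^(u-1), which is
   u * sum_X v(X) X up to sign, vanishes.  Hence 1 is in Cl(j), and the code
   consists of the v with sum_X v(X) = 0 and sum_X v(X) X = 0: it is the dual of
   the code B of affine functions G = F_p^m -> F_p.

   B has p^(m+1) words and is self-orthogonal because sum_x x_i x_j = 0 over
   F_p^m when p > 3 or m > 2.  The CSS code spanned by the states |x + B>, x in
   the dual of B, is pure up to the minimum distance dA of the dual, and it does
   not detect the shift by a word w of weight dA outside B.  If the dimension
   is not 1, every w of weight dA is outside B: a nonzero affine function has
   weight at least p^m - p^(m-1), which then exceeds m + 2 >= dA.  If it is 1,
   purity already fails at w. *)

Require Import Defs.
From HB Require Import structures.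
From mathcomp Require Import all_boot all_order all_algebra all_field.
From mathcomp Require Import qpoly complex.
From mathcomp Require Import boolp classical_sets reals trigo.
From mathcomp Require Import ring lra zify.

Set Implicit Arguments.
Unset Strict Implicit.
Unset Printing Implicit Defensive.

Import Order.TTheory GRing.Theory Num.Theory.
Local Open Scope ring_scope.

(** * Characters of F_p from a complex p-th root of unity *)

Section RootOfUnity.

Variables (R : realType) (p : nat).
Hypothesis p_prime : prime p.

Local Notation w := (omega R p).

Lemma omegaX k :
  w ^+ k =
  Complex (cos (k%:R * (2 * pi / p%:R))) (sin (k%:R * (2 * pi / p%:R))).
Proof.
elim: k => [|k IHk]; first by rewrite expr0 mul0r cos0 sin0.
rewrite exprSr IHk /omega; set t := _ / _.
by rewrite -natr1 (mulrDl k%:R) mul1r cosD sinD; congr Complex; rewrite addrC.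
Qed.

(** Since p >= 2, the angle 2 pi / p lies in [0, pi], where cosine is injective; cosine 1 would
    force the angle to be 0. *)
Lemma omega_neq1 : w != 1.
Proof.
have p_gt0 : 0 < p%:R :> R by rewrite ltr0n prime_gt0.
have p_ge2 : 2 <= p%:R :> R by rewrite ler_nat prime_gt1.
have pi0 := pi_gt0 R.
apply/eqP=> -[cos1 _].
have theta_itv : 2 * (pi : R) / p%:R \in `[0, pi]%R.
   rewrite in_itv /=; apply/andP; split; first by rewrite divr_ge0 ?ltW //
     mulr_gt0.
  by rewrite ler_pdivrMr // mulrC ler_pM2l.
have := cos_inj theta_itv (_ : 0 \in `[0, pi]%R).
rewrite cos1 cos0 in_itv /= lexx ltW // => /(_ isT erefl)/eqP.
by rewrite gt_eqF // divr_gt0 //; lra.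
Qed.

Lemma omega_prim : p.-primitive_root w.
Proof.
have p_gt0 := prime_gt0 p_prime.
have wp1 : w ^+ p = 1.
  have pE : p%:R * (2 * pi / p%:R) = pi *+ 2 :> R.
    by rewrite mulrC divfK ?pnatr_eq0 -?lt0n // mulr_natl.
  by rewrite omegaX pE cos2pi sin2pi.
have [d] := prim_order_exists p_gt0 wp1.
move/primeP: p_prime => [_ dP] d_prim /dP /orP[] /eqP dE;
  last by rewrite dE in d_prim.
by have := prim_expr_order d_prim; rewrite dE expr1 => /eqP;
  rewrite (negPf omega_neq1).
Qed.

(** The sum in F_p is reduced modulo p, which powers of a p-th root of unity do not see. *)
Lemma omegaD (a b : 'F_p) : w ^+ (a + b : 'F_p)%R = w ^+ a * w ^+ b.
Proof.
rewrite -exprD -[RHS](prim_expr_mod omega_prim); congr (_ ^+ _).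
by rewrite /=; congr (_ %% _)%N; rewrite Fp_cast.
Qed.

Lemma omega_sum (I : finType) (f : I -> 'F_p) :
  \prod_i w ^+ (f i) = w ^+ (\sum_i f i : 'F_p)%R.
Proof.
symmetry; apply: (big_morph (fun a : 'F_p => w ^+ a)) => [a b|]; last by [].
exact: omegaD.
Qed.

Lemma omega_eq1 (a : 'F_p) : (w ^+ a == 1) = (a == 0).
Proof.
rewrite -(prim_order_dvd omega_prim).
have a_lt : (a < p)%N by have := ltn_ord a; rewrite {2}Fp_cast.
apply/idP/eqP => [pa|->]; last exact: dvdn0.
by apply/val_inj/eqP; rewrite /= -(modn_small a_lt) -/(dvdn _ _).
Qed.

End RootOfUnity.

(** * Dot product, dual code and character sums *)

Section DotProduct.

Variables (F : comNzRingType) (I : finType).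
Implicit Types x y : {ffun I -> F}.

Definition dot x y := \sum_i x i * y i.

Lemma dotC x y : dot x y = dot y x.
Proof. by apply: eq_bigr => i _; rewrite mulrC. Qed.

Lemma dotDr x y z : dot x (y + z) = dot x y + dot x z.
Proof. by rewrite -big_split; apply: eq_bigr => i _; rewrite ffunE mulrDr. Qed.

Lemma dotNr x y : dot x (- y) = - dot x y.
Proof. by rewrite -sumrN; apply: eq_bigr => i _; rewrite ffunE mulrN. Qed.

Lemma dotBr x y z : dot x (y - z) = dot x y - dot x z.
Proof. by rewrite dotDr dotNr. Qed.

End DotProduct.

Section Dual.

Variables (R : realType) (p N : nat).
Hypothesis p_prime : prime p.
Local Notation word := {ffun 'I_N -> 'F_p}.
Local Notation w := (omega R p).

Variable B : {set word}.
Hypothesis B0 : 0 \in B.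
Hypothesis BB : {in B &, forall x y, x - y \in B}.

(** An additive subgroup over the prime field F_p is a linear code, so for the subgroups [B]
    considered here this is the usual dual code. *)
Definition dual : {set word} := [set x | [forall b in B, dot b x == 0]].

Lemma dualP x : reflect (forall b, b \in B -> dot b x = 0) (x \in dual).
Proof.
rewrite inE; apply: (iffP forall_inP) => xP b Bb; first exact/eqP/xP.
by rewrite xP.
Qed.

Lemma dualB : {in dual &, forall x y, x - y \in dual}.
Proof.
by move=> x y /dualP xP /dualP yP; apply/dualP=> b Bb;
  rewrite dotBr xP ?yP ?subr0.
Qed.

Lemma dualBr x y : y \in dual -> (x - y \in dual) = (x \in dual).
Proof.
move=> y_dual; apply/idP/idP => [xy_dual|x_dual]; last exact: dualB.
have -> : x = (x - y) - (0 - y) by rewrite sub0r opprK subrK.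
by apply: dualB => //; apply: dualB => //; apply/dualP => b _;
  rewrite /dot big1 // => i _; rewrite ffunE mulr0.
Qed.

Lemma subgroupN x : (- x \in B) = (x \in B).
Proof.
suff BN y : y \in B -> - y \in B by apply/idP/idP => /BN //; rewrite opprK.
by move=> By; rewrite -sub0r BB.
Qed.

Lemma subgroupDr x y : y \in B -> (x + y \in B) = (x \in B).
Proof.
move=> By; apply/idP/idP => [Bxy|Bx]; first by rewrite -[x](addrK y) BB.
by rewrite -[y]opprK BB ?subgroupN.
Qed.

(** Orthogonality of characters: if [dot b t] is nonzero for some t in [B], translating the
    summation index by t multiplies the sum by a root of unity other than 1, so the sum vanishes. *)
Lemma sum_character (b : word) :
  \sum_(s in B) w ^+ (dot b s : 'F_p) = (b \in dual)%:R * #|B|%:R.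
Proof.
have [b_dual|] := boolP (b \in dual).
  rewrite (eq_bigr (fun=> 1)) ?sumr_const ?mul1r // => s Bs.
  by rewrite dotC (dualP _ b_dual).
rewrite inE negb_forall_in => /exists_inP[t Bt bt_neq0].
set S := \sum_(s in B) _.
have : S = S * w ^+ (dot b t : 'F_p).
  rewrite {1}/S (reindex_inj (addIr t)) mulr_suml /=.
  by apply: eq_big => [s|s _]; rewrite ?subgroupDr // dotDr omegaD.
move/eqP; rewrite -subr_eq0 -{1}[S]mulr1 -mulrBr mulf_eq0 subr_eq0 [1 ==
  _]eq_sym.
by rewrite omega_eq1 // dotC (negPf bt_neq0) orbF mul0r => /eqP.
Qed.

End Dual.

Section DualCard.

Variables (p N : nat).
Hypothesis p_prime : prime p.
Local Notation word := {ffun 'I_N -> 'F_p}.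
Variable B : {set word}.
Hypothesis B0 : 0 \in B.
Hypothesis BB : {in B &, forall x y, x - y \in B}.

(* [R] only provides the roots of unity of the character sums. *)
Lemma card_dual (R : realType) : (#|B| * #|dual B|)%N = (p ^ N)%N.
Proof.
pose T : {set word} := [set: word].
have cardT : #|T| = (p ^ N)%N by rewrite cardsT card_ffun card_Fp // card_ord.
have dualT b : (b \in dual T) = (b == 0).
  apply/dualP/eqP => [bT|-> t _]; last by rewrite /dot big1 // => i _;
    rewrite ffunE mulr0.
  apply/ffunP => i; rewrite ffunE.
  have := bT [ffun j => (j == i)%:R] (finset.in_setT _).
  rewrite /dot (bigD1 i) //= ffunE eqxx mul1r big1 ?addr0 // => j /negPf ji.
  by rewrite ffunE ji mul0r.
apply/eqP; rewrite -(eqr_nat R[i]); apply/eqP.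
(* The double character sum is evaluated in both orders: summing over b first leaves only x in the
   dual, summing over x first leaves only b = 0. *)
transitivity (\sum_(x : word) \sum_(b in B) (omega R p) ^+ (dot x b : 'F_p)).
  rewrite natrM (eq_bigr _ (fun x _ => sum_character R p_prime B0 BB x)).
  rewrite -mulr_suml mulrC; congr (_ * _).
  by rewrite -natr_sum; congr (_%:R); rewrite -big_mkcond sum1_card.
rewrite exchange_big /= -cardT.
have T0 : 0 \in T by rewrite finset.in_setT.
have TB : {in T &, forall x y, x - y \in T} by move=> x y _ _;
  rewrite finset.in_setT.
transitivity (\sum_(b in B) (b == 0)%:R * #|T|%:R : R[i]).
  apply: eq_bigr => b _; rewrite -dualT -(sum_character R p_prime T0 TB b).
  by apply: eq_big => [x|x _]; rewrite ?inE // dotC.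
rewrite (bigD1 (0 : word)) //= eqxx mul1r big1 ?addr0 // => b /andP[_ /negPf
  ->].
by rewrite mul0r.
Qed.

End DualCard.

(** * The CSS code of a self-orthogonal code *)

Section CSS.

Variables (R : realType) (p N : nat).
Local Notation word := {ffun 'I_N -> 'F_p}.
Local Notation w := (omega R p).
Local Notation qudits := (qudit_space R p N).

Variable B : {set word}.

(** For self-orthogonal [B], averaging the amplitudes over translates by [B] and discarding those
    outside the dual projects onto the span of the coset states |x + B>, x in the dual. *)
Definition css_fun (u : qudits) : qudits :=
  [ffun y => (y \in dual B)%:R * (#|B|%:R^-1 * \sum_(s in B) u (y + s))].

Fact css_fun_is_linear : linear css_fun.
Proof.
move=> k u v; apply/ffunP => y; rewrite !ffunE /GRing.scale /=.
rewrite (eq_bigr (fun s => k * u (y + s) + v (y + s))) => [|s _];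
  last by rewrite !ffunE.
by rewrite big_split -mulr_sumr /=; ring.
Qed.

HB.instance Definition _ :=
  GRing.isLinear.Build R[i] qudits qudits *:%R css_fun css_fun_is_linear.

Definition css_proj : 'End(qudits) := linfun css_fun.

Lemma css_projE u y :
  css_proj u y = (y \in dual B)%:R * (#|B|%:R^-1 * \sum_(s in B) u (y + s)).
Proof. by rewrite lfunE /= ffunE. Qed.

Hypothesis p_prime : prime p.

(** The tensor product of the X(a_i) Z(b_i) has a single nonzero entry in row y, at column y - a;
    the phases of its factors multiply to one character value. *)
Lemma error_opE (a b : word) (u : qudits) y :
  error_op R a b u y = w ^+ (dot b (y - a) : 'F_p) * u (y - a).
Proof.
rewrite lfunE /= ffunE (bigD1 (y - a)) //= [X in _ + X]big1 ?addr0 => [|x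
  x_neq].
 congr (_ * _); rewrite -omega_sum //; apply: eq_bigr => i _.
  rewrite !mxE (bigD1 (y i - a i)) //= big1 ?addr0 => [|z z_neq].
    by rewrite !mxE !ffunE subrK !eqxx mul1r.
  by rewrite !mxE !ffunE (negPf z_neq) mulr0.
suff [i xi_neq] : exists i, y i != x i + a i.
  rewrite (bigD1 i) //= mxE big1 ?mul0r // => z _; rewrite !mxE.
  have [->|] := eqVneq z (x i); last by rewrite mulr0.
  by rewrite (negPf xi_neq) mul0r.
apply/existsP; apply: contra_neqT x_neq => /existsPn yE.
by apply/ffunP => i; have /negPn/eqP := yE i; rewrite !ffunE => ->;
  rewrite addrK.
Qed.

Hypothesis B0 : 0 \in B.
Hypothesis BB : {in B &, forall x y, x - y \in B}.
Hypothesis B_dual : {subset B <= dual B}.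

Let cardB_neq0 : #|B|%:R != 0 :> R[i].
Proof. by rewrite pnatr_eq0 -lt0n; apply/card_gt0P; exists 0. Qed.

Lemma subgroup_shift (M : nmodType) (F : word -> M) t :
  t \in B -> \sum_(s in B) F (t + s) = \sum_(s in B) F s.
Proof.
move=> Bt; rewrite [RHS](reindex_inj (addrI t)).
by apply: eq_bigl => s; rewrite addrC subgroupDr.
Qed.

Lemma dualDr x s : s \in B -> (x + s \in dual B) = (x \in dual B).
Proof. by move=> Bs; rewrite -[s]opprK dualBr // B_dual // subgroupN. Qed.

Lemma css_proj_shift u x s : s \in B -> css_proj u (x + s) = css_proj u x.
Proof.
move=> Bs; rewrite !css_projE dualDr //; congr (_ * (_ * _)).
by rewrite -(subgroup_shift (fun t => u (x + t)) Bs); apply: eq_bigr => t _;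
  rewrite addrA.
Qed.

Lemma css_proj_supp u x : x \notin dual B -> css_proj u x = 0.
Proof. by move=> /negPf xB; rewrite css_projE xB mul0r. Qed.

(** Periodicity modulo [B] and support in the dual characterise the image; idempotence and the
    dimension both rest on this. *)
Lemma css_proj_id (u : qudits) :
    (forall x s, s \in B -> u (x + s) = u x) ->
    (forall x, x \notin dual B -> u x = 0) ->
  css_proj u = u.
Proof.
move=> uB u_supp; apply/ffunP=> x; rewrite css_projE.
have [xB|/u_supp ->] := boolP (x \in dual B); last by rewrite mul0r.
rewrite mul1r (eq_bigr (fun=> u x)) => [|s Bs]; last exact: uB.
by rewrite sumr_const -(mulr_natl (u x)) mulKf.
Qed.

Lemma css_orthogonal_projector : orthogonal_projector (limg css_proj) css_proj.
Proof.
split=> // [|u v].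
  apply/lfunP => u; rewrite comp_lfunE css_proj_id // => x s;
    first exact: css_proj_shift.
  exact: css_proj_supp.
rewrite /hdot.
transitivity (#|B|%:R^-1 * \sum_(s in B) \sum_(x in dual B) (u (x + s))^* * v
  x).
  rewrite exchange_big [in RHS]big_mkcond mulr_sumr; apply: eq_bigr => x _ /=.
  rewrite css_projE; case: ifP => xB; last by rewrite mul0r rmorph0 mul0r mulr0.
  rewrite mul1r rmorphM fmorphV rmorph_nat -mulrA; congr (_ * _).
  by rewrite rmorph_sum mulr_suml.
(* Replacing s by -s, then x by x + s, moves the shift from u to v; [B] and its dual are stable
   under these substitutions. *)
rewrite (reindex_inj (@oppr_inj word)).
rewrite (eq_bigl _ _ (subgroupN B0 BB)).
transitivity (#|B|%:R^-1 * \sum_(s in B) \sum_(x in dual B) (u x)^* * v (x +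
  s)).
  congr (_ * _); apply: eq_bigr => s Bs; rewrite (reindex_inj (addIr s)) /=.
  by apply: eq_big => [x|x _]; rewrite ?dualDr // addrK.
rewrite exchange_big [in LHS]big_mkcond mulr_sumr; apply: eq_bigr => x _ /=.
rewrite css_projE; case: ifP => xB; last by rewrite mul0r !mulr0.
by rewrite mul1r mulrCA -mulr_sumr.
Qed.

(** A projected state is periodic modulo [B], so averaging its image under the error over [B] only
    averages the phases, and [sum_character] decides whether they cancel. *)
Lemma css_proj_errorE a b u y :
  (css_proj \o error_op R a b \o css_proj)%VF u y =
  ((y \in dual B) && (b \in dual B))%:R * error_op R a b (css_proj u) y.
Proof.
rewrite !comp_lfunE css_projE -mulnb natrM -!mulrA; congr (_ * _).
rewrite error_opE.
transitivity (#|B|%:R^-1 * ((\sum_(s in B) w ^+ (dot b s : 'F_p)) *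
    (w ^+ (dot b (y - a) : 'F_p) * css_proj u (y - a)))).
  congr (_ * _); rewrite mulr_suml; apply: eq_bigr => s Bs.
  rewrite error_opE addrAC dotDr omegaD // (css_proj_shift _ _ Bs).
  by rewrite mulrA [X in X * _]mulrC.
by rewrite (sum_character R p_prime B0 BB) -mulrA mulrCA mulKf.
Qed.

(** If b is outside the dual the phases cancel; if a is, the shift by a moves the dual off itself,
    so the supports are disjoint. *)
Lemma css_proj_error0 a b : (a \notin dual B) || (b \notin dual B) ->
  (css_proj \o error_op R a b \o css_proj)%VF = 0.
Proof.
move=> abB; apply/lfunP => u; apply/ffunP => y.
rewrite css_proj_errorE error_opE zero_lfunE [RHS]ffunE.
have [bB|_] := boolP (b \in dual B); last by rewrite andbF mul0r.
have [aB|aB] := boolP (a \in dual B); first by rewrite aB bB in abB.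
have [yB|_] := boolP (y \in dual B); last by rewrite mul0r.
rewrite css_proj_supp ?mulr0 //; apply: contra aB => /(dualB yB).
by rewrite opprB addrC subrK.
Qed.

(** Such shifts permute the coset states. With a = 0 this handles the trivial error, with a of
    minimum weight it exhibits an undetected one. *)
Lemma css_proj_shift_error a u y : a \in dual B ->
  (css_proj \o error_op R a 0 \o css_proj)%VF u y = css_proj u (y - a).
Proof.
move=> aB; rewrite css_proj_errorE error_opE.
have dot0 x : dot (0 : word) x = 0.
  by rewrite /dot big1 // => i _; rewrite ffunE mul0r.
have B00 : 0 \in dual B by apply: B_dual.
rewrite dot0 expr0 mul1r B00 andbT.
have [yB|yB] := boolP (y \in dual B); first by rewrite mul1r.
by rewrite mul0r css_proj_supp // dualBr.
Qed.

(** * Cosets of [B] in its dual and the dimension of the CSS code *)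

Definition translate (x : word) : {set word} := [set y : word | y - x \in B].

Lemma eq_translate x y : (translate x == translate y) = (x - y \in B).
Proof.
apply/eqP/idP => [/setP/(_ x)|xyB]; first by rewrite !inE subrr B0.
apply/setP => z; rewrite !inE -(subgroupDr B0 BB (z - x) xyB).
by rewrite addrA subrK.
Qed.

Definition cosets : {set {set word}} := translate @: dual B.

Lemma card_cosets : (#|cosets| * #|B|)%N = #|dual B|.
Proof.
rewrite -[RHS]sum1_card (partition_big_imset translate) /= -/cosets
  -sum_nat_const.
apply: eq_bigr => _ /imsetP[x xB ->]; rewrite sum1dep_card.
rewrite -(card_imset _ (addrI x)); apply: eq_card => y;
  rewrite [RHS]inE eq_translate.
apply/imsetP/andP => [[s sB ->]|[yB yxB]];
  first by rewrite dualDr // addrC addKr.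
by exists (y - x) => //; rewrite addrC subrK.
Qed.

Local Notation coset_type := {S : {set word} | S \in cosets}.

(** [insub] fails exactly for y outside the dual, so the default 0 is the support condition on code
    states. *)
Definition coset_state (f : {ffun coset_type -> (R[i])^o}) : qudits :=
  [ffun y => if insub (translate y) is Some T then f T else 0].

Fact coset_state_is_linear : linear coset_state.
Proof.
move=> k u v; apply/ffunP => y; rewrite !ffunE; case: insubP => [S _ _|_].
  by rewrite !ffunE.
by rewrite scaler0 addr0.
Qed.

HB.instance Definition _ :=
  GRing.isLinear.Build R[i] _ _ *:%R coset_state coset_state_is_linear.

Lemma translate_cosets x : (translate x \in cosets) = (x \in dual B).
Proof.
apply/imsetP/idP => [[y yB /eqP]|]; last by exists x.
rewrite eq_translate => xyB.
by rewrite -[x](subrK y) addrC dualDr.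
Qed.

(** [coset_state] is injective with the same image as the projector, so the dimension is the number
    of cosets. *)
Lemma dim_css : \dim (limg css_proj) = #|cosets|.
Proof.
have -> : limg css_proj = limg (linfun coset_state).
  apply/eqP; rewrite eqEsubv; apply/andP; split;
    apply/subvP => _ /memv_imgP[u _ ->].
    pose f : {ffun coset_type -> (R[i])^o} :=
      [ffun T : coset_type => (#|B|%:R^-1 * \sum_(z in val T) u z : (R[i])^o)].
    suff -> : css_proj u = linfun coset_state f by rewrite memv_img ?memvf.
    apply/ffunP => y; rewrite css_projE lfunE ffunE.
    case: insubP => [T|]; rewrite translate_cosets; last by move/negPf->;
      rewrite mul0r.
    move=> -> TE.
    rewrite mul1r ffunE TE [in RHS](reindex_inj (addrI y)); congr (_ * _).
    by apply: eq_bigl => z; rewrite inE addrC addKr.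
  rewrite -[X in X \in _]css_proj_id ?memv_img ?memvf // => [x s sB|x xB].
    rewrite lfunE !ffunE.
    suff -> : translate (x + s) = translate x by [].
    by apply/eqP; rewrite eq_translate addrC addKr.
  by rewrite lfunE ffunE insubN // translate_cosets.
rewrite limg_dim_eq; last first.
  apply/eqP; rewrite -subv0; apply/subvP => f;
    rewrite memv_cap memvf memv_ker /=.
  rewrite lfunE memv0 => /eqP/ffunP f0; apply/eqP/ffunP => -[S SQ].
  have [x xB SE] := imsetP SQ.
  by have := f0 x; rewrite !ffunE -SE insubT.
rewrite dimvf; transitivity (#|{: coset_type}| * 1)%N; first by [].
by rewrite muln1 card_sig; apply: eq_card => T.
Qed.

Lemma dim_css_pow k :
  #|B| = (p ^ k)%N -> \dim (limg css_proj) = (p ^ (N - 2 * k))%N.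
Proof.
move=> cardB; rewrite dim_css.
have p_gt0 := prime_gt0 p_prime.
have BN := card_dual p_prime B0 BB R.
(* Self-orthogonality gives p^(2k) <= p^N, so N - 2k is a genuine difference. *)
have k2_le : (2 * k <= N)%N.
  rewrite -(leq_exp2l _ _ (prime_gt1 p_prime)) -BN mul2n -addnn expnD -cardB.
  by rewrite leq_mul2l subset_leq_card ?orbT //; apply/fintype.subsetP.
apply/eqP; rewrite -(eqn_pmul2r (_ : 0 < p ^ (2 * k))%N) ?expn_gt0 ?p_gt0 //.
by rewrite -expnD subnK // -BN -card_cosets cardB mul2n -addnn expnD mulnCA
  mulnA.
Qed.

(** * Weights, purity and distance of the CSS code *)

Definition weight (x : word) : nat := #|[pred i | x i != 0]|.

Lemma weight_gt0 x : (0 < weight x)%N = (x != 0).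
Proof.
apply/card_gt0P/idP => [[j]|x0].
  by rewrite inE; apply: contraNneq => ->; rewrite ffunE.
apply/existsP; apply: contraNT x0 => /existsPn x0.
by apply/eqP/ffunP => j; rewrite ffunE; apply/eqP/negPn/x0.
Qed.

Lemma weight_le_error (a b : word) :
  (weight a <= error_weight a b)%N && (weight b <= error_weight a b)%N.
Proof.
by apply/andP; split; apply/subset_leq_card/fintype.subsetP => i;
  rewrite !inE xpair_eqE negb_and => ->; rewrite ?orbT.
Qed.

Lemma error_weight_shift (a : word) : error_weight a 0 = weight a.
Proof. by apply: eq_card => i; rewrite !inE xpair_eqE ffunE eqxx andbT. Qed.

Lemma error_weight_gt0 (a b : word) :
  (0 < error_weight a b)%N = ((a, b) != (0, 0)).
Proof.
apply/idP/idP => [|].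
  move/card_gt0P => [j]; rewrite inE; apply: contraNN; rewrite !xpair_eqE.
  by move=> /andP[/eqP-> /eqP->]; rewrite !ffunE eqxx.
rewrite xpair_eqE negb_and -!weight_gt0; have /andP[aw bw] := weight_le_error a
  b.
by case/orP => /leq_trans; apply.
Qed.

Variable d : nat.
Hypothesis dual_weight : forall x, x \in dual B -> x != 0 -> (d <= weight x)%N.

(** A nontrivial error of weight below d has a nonzero component a or b, also of weight below d;
    that component lies outside the dual and [css_proj_error0] applies. *)
Lemma css_pure : pure_code css_proj d.
Proof.
move=> a b; rewrite error_weight_gt0 => /andP[ab0 ab_lt];
  apply: css_proj_error0.
apply: contraNT ab0; rewrite negb_or !negbK xpair_eqE => /andP[aB bB].
have /andP[aw bw] := weight_le_error a b.
by apply/andP; split; apply: contraLR ab_lt => x0; rewrite -leqNgt;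
  [apply: leq_trans (dual_weight aB x0) aw | apply: leq_trans (dual_weight bB
    x0) bw].
Qed.

(** Nontrivial errors give the scalar 0 by purity, the trivial one gives 1. *)
Lemma css_detects : detects_below css_proj d.
Proof.
move=> a b ab_lt; have [ab0|] := boolP (0 < error_weight a b)%N.
  by exists 0; rewrite scale0r; apply: css_pure; rewrite ab0.
rewrite error_weight_gt0 negbK xpair_eqE => /andP[/eqP-> /eqP->]; exists 1;
  rewrite scale1r.
apply/lfunP => u; apply/ffunP => y.
by rewrite css_proj_shift_error ?subr0 // B_dual.
Qed.

Lemma css_quantum_code k v : #|B| = (p ^ k)%N -> v \in dual B -> v != 0 ->
  weight v = d ->
  (N - 2 * k != 0 -> v \notin B)%N ->
  quantum_code (limg css_proj) css_proj (N - 2 * k) d.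
Proof.
move=> cardB vB v0 vd v_notB; split; [exact: dim_css_pow|exact:
  css_orthogonal_projector|].
(* The coset state of [B] itself is the test state: the shift by v carries its amplitude 1 from 0 to
   v. This contradicts purity, and, for v outside [B], also proportionality to the projector, as the
   projected state vanishes at v. *)
pose u : qudits := [ffun x => (x \in B)%:R].
have Pu0 : css_proj u 0 = 1.
  rewrite css_projE B_dual // mul1r (eq_bigr (fun=> 1)) => [|s sB];
    last by rewrite ffunE add0r sB.
  by rewrite sumr_const mulVf.
have PuN x : x \notin B -> css_proj u x = 0.
  move=> /negPf xB; rewrite css_projE big1 ?mulr0 // => s sB.
  by rewrite ffunE subgroupDr // xB.
have PEPv : (css_proj \o error_op R v 0 \o css_proj)%VF u v = 1.
  by rewrite css_proj_shift_error // subrr.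
have w_gt0 : (0 < error_weight v (0%R : word))%N by rewrite error_weight_shift
  weight_gt0.
split=> [|d' Qd']; first by case: ifP => _; [exact: css_pure|exact:
  css_detects].
rewrite leqNgt -vd -error_weight_shift; apply/negP => d_lt.
case: ifP Qd' => [_ /(_ v (0 : word))|/negbT K0 /(_ v (0 : word) d_lt)[c]] E.
  by move: PEPv; rewrite E ?w_gt0 // zero_lfunE ffunE => /eqP;
    rewrite eq_sym oner_eq0.
by move: PEPv; rewrite E scale_lfunE !ffunE PuN ?v_notB // scaler0 => /eqP;
  rewrite eq_sym oner_eq0.
Qed.

End CSS.

(** * The code of affine functions *)

Import VectorInternalTheory.

(** G is an F_p-vector space of dimension m. Additivity of the coordinates suffices, since scaling
    by F_p is repeated addition. *)
Lemma Fp_coordinates (p m : nat) (G : finFieldType) :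
    prime p -> #|G| = (p ^ m)%N ->
  exists2 e : G -> {ffun 'I_m -> 'F_p}, bijective e & {morph e : x y / x + y}.
Proof.
move=> p_prime cardG; have pcharG := card_finPcharP cardG p_prime.
pose L := pPrimeCharType pcharG.
have dimL : dim L = m by rewrite -dimvf pprimeChar_dimf cardG pfactorK.
pose c : L -> 'rV['F_p]_(dim L) := v2r.
have cD (x y : L) : c (x + y) = c x + c y by exact: raddfD.
exists (fun x : L => [ffun i => c x 0 (cast_ord (esym dimL) i)]); last first.
  by move=> x y; apply/ffunP => i; rewrite !ffunE [c _]cD mxE.
apply: inj_card_bij => [x y /ffunP xyE|]; last first.
  by rewrite card_ffun card_Fp // card_ord -cardG.
suff cE : c x = c y by exact: v2r_inj cE.
apply/rowP => j.
by have := xyE (cast_ord dimL j); rewrite !ffunE cast_ordK.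
Qed.

(** * Vanishing sums of monomials of degree at most 2 *)

Section PowerSums.

Variable p : nat.
Hypothesis p_prime : prime p.

(** For k = 0 the sum is p = 0. For k = 1 or 2, substituting 2y for y gives S = 2^k S, and 2^k - 1
    is 1 or 3, nonzero modulo p > 3. *)
Lemma sum_Fp_pow k : (k == 0)%N || (3 < p)%N && (k <= 2)%N ->
  \sum_(y : 'F_p) y ^+ k = 0.
Proof.
case/orP => [/eqP->|/andP[p3 k2]].
  by rewrite sumr_const card_Fp // pchar_Fp_0.
have [->|k0] := posnP k; first by rewrite sumr_const card_Fp // pchar_Fp_0.
have nat_neq0 n : (0 < n < p)%N -> n%:R != 0 :> 'F_p.
  move=> /andP[n0 np]; rewrite -(dvdn_pcharf (pchar_Fp p_prime)).
  by apply: contraL np => /(dvdn_leq n0); rewrite leqNgt.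
have two_neq0 : 2 != 0 :> 'F_p by apply: nat_neq0; apply: ltnW.
set S := \sum_y _.
have /eqP : S = 2 ^+ k * S.
  rewrite {1}/S (reindex_inj (mulfI two_neq0)) mulr_sumr.
  by apply: eq_bigr => y _; rewrite exprMn.
rewrite -subr_eq0 -{1}[S]mul1r -mulrBl mulf_eq0 => /orP[|/eqP //].
rewrite -oppr_eq0 opprB -natrX -[X in _ - X]/(1%:R) -natrB ?expn_gt0 //.
have /negPf-> // : (2 ^ k - 1)%:R != 0 :> 'F_p.
apply: nat_neq0; have [->|->] : k = 1%N \/ k = 2%N by lia.
  by rewrite /= (ltn_trans _ p3).
by rewrite /=.
Qed.

(** The sum factors into one-variable power sums. If p > 3 every factor vanishes; if m > 2 some
    variable has exponent 0 and its factor vanishes. *)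
Lemma sum_monomial m (f : 'I_m -> nat) :
    (0 < m)%N -> (3 < p)%N \/ (2 < m)%N -> (\sum_l f l <= 2)%N ->
  \sum_(x : {ffun 'I_m -> 'F_p}) \prod_l x l ^+ f l = 0.
Proof.
move=> m_gt0 pm f2.
rewrite -(bigA_distr_bigA (fun l y => y ^+ f l)) /=.
suff [l fl] : exists l, ((f l == 0) || (3 < p) && (f l <= 2))%N.
  by rewrite (bigD1 l) //= sum_Fp_pow // mul0r.
have [p3|m2] := pm.
  exists (Ordinal m_gt0); apply/orP; right; rewrite p3 /=.
  by apply: leq_trans f2; rewrite (bigD1 (Ordinal m_gt0)) //= leq_addr.
suff /existsP[l fl] : [exists l, f l == 0%N] by exists l; rewrite fl.
apply: contraLR m2; rewrite negb_exists -leqNgt => /forallP f_neq0.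
apply: leq_trans f2; rewrite -[X in (X <= _)%N]card_ord -sum1_card.
by apply: leq_sum => l _; rewrite lt0n.
Qed.

End PowerSums.

(** * Size, self-orthogonality and weights of the affine code, and light words of its dual *)

Section AffineCode.

Variables (p m N : nat) (E : 'I_N -> {ffun 'I_m -> 'F_p}).
Hypothesis p_prime : prime p.
Hypothesis E_bij : bijective E.

Definition affine_word (q : 'F_p * {ffun 'I_m -> 'F_p}) : {ffun 'I_N -> 'F_p} :=
  [ffun k => q.1 + dot q.2 (E k)].

Definition affine_code : {set {ffun 'I_N -> 'F_p}} :=
  [set affine_word q | q : _].

Lemma affine_word_code q : affine_word q \in affine_code.
Proof. exact: imset_f. Qed.

Lemma affine_wordB q r : affine_word q - affine_word r = affine_word (q - r).
Proof.
apply/ffunP => k; rewrite !ffunE [dot (q - r).2 _]dotC dotBr ![dot (E k) _]dotC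
  /=.
by rewrite opprD addrACA.
Qed.

Lemma affine_codeB : {in affine_code &, forall x y, x - y \in affine_code}.
Proof. by move=> _ _ /imsetP[q _ ->] /imsetP[r _ ->];
  rewrite affine_wordB affine_word_code. Qed.

Lemma affine_code0 : 0 \in affine_code.
Proof.
apply/imsetP; exists 0 => //; apply/ffunP => k.
by rewrite !ffunE /dot big1 ?addr0 // => i _; rewrite ffunE mul0r.
Qed.

Lemma dot_delta (a : {ffun 'I_m -> 'F_p}) i t :
  dot a [ffun j => if j == i then t else 0] = a i * t.
Proof.
rewrite /dot (bigD1 i) //= ffunE eqxx big1 ?addr0 // => j /negPf ji.
by rewrite ffunE ji mulr0.
Qed.

Lemma affine_word_inj : injective affine_word.
Proof.
have [Ei EK EiK] := E_bij.
have dotE q r x : affine_word q = affine_word r -> q.1 + dot q.2 x = r.1 + dot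
  r.2 x.
  by move/ffunP/(_ (Ei x)); rewrite !ffunE EiK.
move=> [c a] [c' a'] /dotE qrE; have /= cE := qrE 0.
have dot0 (b : {ffun 'I_m -> 'F_p}) : dot b 0 = 0.
  by rewrite /dot big1 // => i _; rewrite ffunE mulr0.
rewrite !dot0 !addr0 in cE; congr (_, _) => //; apply/ffunP => i.
have := qrE [ffun j => if j == i then 1 else 0].
by rewrite /= cE !dot_delta !mulr1 => /addrI.
Qed.

Lemma card_affine_code : #|affine_code| = (p ^ m.+1)%N.
Proof.
by rewrite card_imset; [rewrite card_prod card_ffun card_Fp // card_ord
  expnS|exact: affine_word_inj].
Qed.

(** The constant 1 and the coordinate functions span the affine functions, so orthogonality is
    tested on them. *)
Lemma dual_affine_codeP (v : {ffun 'I_N -> 'F_p}) :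
  reflect (\sum_k v k = 0 /\ forall i, \sum_k v k * E k i = 0)
    (v \in dual affine_code).
Proof.
have dotE q : dot (affine_word q) v =
    q.1 * \sum_k v k + \sum_i q.2 i * \sum_k v k * E k i.
  rewrite /dot mulr_sumr.
  under [X in _ = _ + X]eq_bigr do rewrite mulr_sumr.
  rewrite exchange_big -big_split; apply: eq_bigr => k _ /=.
  rewrite ffunE mulrDl /dot mulr_suml; congr (_ + _); apply: eq_bigr => i _.
  by rewrite mulrAC -mulrA.
apply: (iffP (dualP _ _)) => [vB|[v0 vE] _ /imsetP[q _ ->]]; last first.
  by rewrite dotE v0 mulr0 add0r big1 // => i _; rewrite vE mulr0.
split=> [|i].
  have := vB _ (affine_word_code (1, 0)); rewrite dotE /= mul1r.
  by rewrite [X in _ + X]big1 ?addr0 // => i _; rewrite ffunE mul0r.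
have := vB _ (affine_word_code (0, [ffun j => (j == i)%:R])).
rewrite dotE /= mul0r add0r (bigD1 i) //= ffunE eqxx mul1r [X in _ + X]big1
  ?addr0 // => j /negPf ji.
by rewrite ffunE ji mul0r.
Qed.

(** A product of two affine functions has degree at most 2, so its sum over F_p^m vanishes by
    [sum_monomial]. *)
Lemma affine_code_dual : (0 < m)%N -> (3 < p)%N \/ (2 < m)%N ->
  {subset affine_code <= dual affine_code}.
Proof.
move=> m_gt0 pm _ /imsetP[[c a] _ ->].
have sumE (f : {ffun 'I_m -> 'F_p} -> 'F_p) : \sum_k f (E k) = \sum_x f x.
  by rewrite [RHS](reindex E) //; apply: onW_bij.
have sum0 : \sum_(x : {ffun 'I_m -> 'F_p}) 1 = 0 :> 'F_p.
  rewrite -[RHS](@sum_monomial p p_prime m (fun=> 0%N)) //;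
    last by rewrite big1.
  by apply: eq_bigr => x _; rewrite big1.
have xE (x : {ffun 'I_m -> 'F_p}) i : x i = \prod_l x l ^+ (l == i).
  by rewrite (bigD1 i) //= eqxx big1 ?mulr1 // => l /negPf ->.
have sum_delta i : (\sum_(l < m) (l == i) = 1)%N.
  by rewrite (bigD1 i) //= eqxx big1 // => l /negPf ->.
have sum1 i : \sum_(x : {ffun 'I_m -> 'F_p}) x i = 0.
  rewrite -[RHS](@sum_monomial p p_prime m (fun l => (l == i) : nat)) //
    ?sum_delta //.
  by apply: eq_bigr => x _; exact: xE.
have sum2 i j : \sum_(x : {ffun 'I_m -> 'F_p}) x i * x j = 0.
  rewrite -[RHS](@sum_monomial p p_prime m (fun l => (l == i) + (l == j))%N) //.
    apply: eq_bigr => x _; rewrite (xE x i) (xE x j) -big_split.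
    by apply: eq_bigr => l _; rewrite exprD.
  by rewrite big_split /= !sum_delta.
apply/dual_affine_codeP; split=> [|j].
  under eq_bigr do rewrite ffunE /=.
  rewrite (sumE (fun x => c + dot a x)) big_split /= -[c]mulr1 -mulr_sumr sum0
    mulr0 add0r.
  by rewrite exchange_big big1 // => i _; rewrite -mulr_sumr sum1 mulr0.
under eq_bigr do rewrite ffunE /=.
rewrite (sumE (fun x => (c + dot a x) * x j)).
under eq_bigr do rewrite mulrDl /dot mulr_suml.
rewrite big_split /= -mulr_sumr sum1 mulr0 add0r exchange_big big1 // => i _.
by under eq_bigr do rewrite -mulrA; rewrite -mulr_sumr sum2 mulr0.
Qed.

(** A nonzero constant has no zeros; a nonconstant affine function takes all p values equally often,
    hence has p^(m-1) zeros. *)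
Lemma weight_affine_code v : (0 < m)%N -> v \in affine_code -> v != 0 ->
  (p ^ m - p ^ m.-1 <= weight v)%N.
Proof.
move=> m_gt0 /imsetP[[c a] _ ->] v0.
have cardN : N = (p ^ m)%N.
  by rewrite -[LHS]card_ord (bij_eq_card E_bij) card_ffun card_Fp // card_ord.
have [/existsP[j aj]|a0] := boolP [exists i, a i != 0]; last first.
  have {}a0 : a = 0.
    by apply/ffunP => i; rewrite ffunE; apply/eqP; apply: contraNT a0 => ai;
      apply/existsP; exists i.
  have wE k : affine_word (c, a) k = c.
    by rewrite ffunE a0 /dot big1 ?addr0 // => i _; rewrite ffunE mul0r.
  have c0 : c != 0.
    by apply: contraNneq v0 => c0; apply/eqP/ffunP => k; rewrite wE c0 ffunE.
  rewrite /weight (eq_card (_ : _ =i 'I_N)) ?card_ord ?cardN ?leq_subr //.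
  by move=> k; rewrite !inE wE c0.
pose f (x : {ffun 'I_m -> 'F_p}) : 'F_p := c + dot a x.
pose Z (t : 'F_p) := #|[pred x | f x == t]|.
have ZE t : Z t = Z 0.
  (* Moving by t / a_j along a coordinate j with a_j nonzero raises f by t. *)
  pose s x := x + [ffun i => if i == j then t / a j else 0].
  have s_inj : injective s by apply: addIr.
  rewrite /Z -(on_card_preimset (_ : {on [pred x | f x == t], bijective s})).
    apply: eq_card => x; rewrite !inE /f dotDr dot_delta mulrC divfK //.
    by rewrite addrA -subr_eq0 addrK.
  exact/onW_bij/injF_bij.
have sumZ : (p * Z 0%R = p ^ m)%N.
  rewrite -cardN -[in RHS](card_ord N) (bij_eq_card E_bij) -sum1_card.
  rewrite (partition_big f xpredT) //=.
  under eq_bigr => t _ do rewrite sum1_card -/(Z t) ZE.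
  by rewrite sum_nat_const card_Fp.
have Z0 : Z 0 = (p ^ m.-1)%N.
  apply/eqP; rewrite -(eqn_pmul2l (prime_gt0 p_prime)) sumZ.
  by rewrite -expnS prednK.
rewrite -Z0 -[in X in (X <= _)%N]cardN -[X in (X - _)%N](card_ord N) leq_subLR.
rewrite -(cardC [pred k | affine_word (c, a) k == 0]) leq_add //.
rewrite /Z -(on_card_preimset (_ : {on [pred x | f x == 0], bijective E})).
  by apply/subset_leq_card/fintype.subsetP => k; rewrite !inE ffunE.
exact: onW_bij.
Qed.

(* The word is supported on the parallelogram 0, a, b, a + b, which degenerates
   to three collinear points when a = b. *)
Lemma dual_parallelogram (a b : {ffun 'I_m -> 'F_p}) :
    a != 0 -> b != 0 -> a + b != 0 ->
  exists2 v, v \in dual affine_code &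
    v != 0 /\ (weight v <= 3 + (a != b))%N.
Proof.
move=> a0 b0 ab0; have [Ei EK EiK] := E_bij.
pose delta x : {ffun 'I_N -> 'F_p} := [ffun k => (E k == x)%:R].
have deltaE x k : delta x k = (E k == x)%:R by rewrite ffunE.
have sum_delta (f : 'I_N -> 'F_p) x : \sum_k delta x k * f k = f (Ei x).
  rewrite (bigD1 (Ei x)) //= deltaE EiK eqxx mul1r big1 ?addr0 // => k.
  by rewrite -(inj_eq (can_inj EK)) EiK deltaE => /negPf->; rewrite mul0r.
(* Affine functions satisfy f(0) - f(a) - f(b) + f(a + b) = 0, so this signed indicator lies in the
   dual. *)
pose v := delta 0 - delta a - delta b + delta (a + b).
have sumv (f : 'I_N -> 'F_p) :
    \sum_k v k * f k = f (Ei 0) - f (Ei a) - f (Ei b) + f (Ei (a + b)).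
  rewrite -!sum_delta -!sumrB -big_split /=; apply: eq_bigr => k _.
  by rewrite /v !ffunE; ring.
exists v; last split.
- apply/dual_affine_codeP; split=> [|i].
    under eq_bigr do rewrite -[v _]mulr1.
    by rewrite sumv; ring.
  by rewrite (sumv (fun k => E k i)) !EiK !ffunE; ring.
- apply/eqP => /ffunP/(_ (Ei 0)); rewrite !ffunE !EiK eqxx.
  rewrite ![0 == _]eq_sym (negPf a0) (negPf b0) (negPf ab0) !subr0 addr0.
  by move/eqP; rewrite oner_eq0.
pose s := if a == b then [:: Ei 0; Ei a; Ei (a + b)] else [:: Ei 0; Ei a;
  Ei b; Ei (a + b)].
have s_size : size s = (3 + (a != b))%N by rewrite /s; case: eqP.
rewrite -s_size; apply: leq_trans (card_size s); apply: subset_leq_card.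
apply/fintype.subsetP => k; rewrite inE; apply: contraR => ks.
have kE x : Ei x \in s -> (E k == x) = false.
  by move=> xs; apply: contraNF ks => /eqP kx; rewrite -(EK k) kx.
rewrite /v !ffunE !kE ?subr0 ?addr0 //; rewrite /s; case: eqP => [->|_];
  rewrite !inE eqxx ?orbT //.
Qed.

(** For p = 2, where m > 2, two unit vectors give weight at most 4. For odd p, a = b gives weight at
    most 3, with 2a nonzero. *)
Lemma dual_light_word : (0 < m)%N -> (3 < p)%N \/ (2 < m)%N ->
  exists2 v, v \in dual affine_code & v != 0 /\ (weight v <= m + 2)%N.
Proof.
move=> m_gt0 pm.
have [p2|p_neq2] := eqVneq p 2%N.
  have m_gt2 : (2 < m)%N by case: pm => //; rewrite p2.
  pose e k : {ffun 'I_m -> 'F_p} := [ffun i => (val i == k)%:R].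
  pose i0 : 'I_m := Ordinal m_gt0; pose i1 : 'I_m := Ordinal (ltnW m_gt2).
  have [|||v vB [v0 wv]] := @dual_parallelogram (e 0%N) (e 1%N).
  - by apply/eqP => /ffunP/(_ i0)/eqP; rewrite !ffunE oner_eq0.
  - by apply/eqP => /ffunP/(_ i1)/eqP; rewrite !ffunE oner_eq0.
  - by apply/eqP => /ffunP/(_ i0)/eqP; rewrite !ffunE addr0 oner_eq0.
  by exists v => //; split=> //; apply: leq_trans wv _; case: eqP => /=; lia.
pose a : {ffun 'I_m -> 'F_p} := [ffun=> 1].
have [|||v vB [v0 wv]] := @dual_parallelogram a a.
- by apply/eqP => /ffunP/(_ (Ordinal m_gt0))/eqP; rewrite !ffunE oner_eq0.
- by apply/eqP => /ffunP/(_ (Ordinal m_gt0))/eqP; rewrite !ffunE oner_eq0.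
- apply/eqP => /ffunP/(_ (Ordinal m_gt0))/eqP;
  rewrite !ffunE -[X in X == _]/(2%:R).
  by rewrite -(dvdn_pcharf (pchar_Fp p_prime)) dvdn_prime2 // (negPf p_neq2).
by exists v => //; split=> //; apply: leq_trans wv _; rewrite eqxx; lia.
Qed.

End AffineCode.

(** * Affine-invariant maximal cyclic codes *)

Section Evaluation.

Variables (p : nat) (G : finFieldType).
Hypothesis pcharG : p \in [pchar G].

Let p_prime : prime p := pcharf_prime pcharG.
Local Notation iota := (@prime_field_incl p G).

Fact prime_field_incl_zmod : zmod_morphism iota.
Proof.
have inclD a b : iota (a + b) = iota a + iota b.
  rewrite /prime_field_incl -natrD -[RHS](GRing.natr_mod_pchar pcharG) /=.
  by congr (_ %% _)%:R; rewrite Fp_cast.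
move=> a b; apply: (addIr (iota b)); by rewrite -inclD !subrK.
Qed.

Fact prime_field_incl_monoid : monoid_morphism iota.
Proof.
split=> [|a b]; first by rewrite /prime_field_incl /= modn_small.
rewrite /prime_field_incl -natrM -[RHS](GRing.natr_mod_pchar pcharG) /=.
by congr (_ %% _)%:R; rewrite Fp_cast.
Qed.

HB.instance Definition _ := GRing.isZmodMorphism.Build _ _ iota
  prime_field_incl_zmod.
HB.instance Definition _ := GRing.isMonoidMorphism.Build _ _ iota
  prime_field_incl_monoid.

Definition poly_eval (c : {poly 'F_p}) (x : G) : G := (map_poly iota c).[x].

Lemma poly_evalD c d x : poly_eval (c + d) x = poly_eval c x + poly_eval d x.
Proof. by rewrite /poly_eval rmorphD hornerD. Qed.

Lemma poly_evalM c d x : poly_eval (c * d) x = poly_eval c x * poly_eval d x.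
Proof. by rewrite /poly_eval rmorphM hornerM. Qed.

Lemma map_Xn_sub1 n : map_poly iota ('X^n - 1) = 'X^n - 1.
Proof. by rewrite rmorphB /= map_polyXn rmorph1. Qed.

Lemma dvdp_map_incl c d : (map_poly iota c %| map_poly iota d) = (c %| d).
Proof. exact: dvdp_map. Qed.

Lemma poly_eval_wide n (c : {poly 'F_p}) x : (size c <= n)%N ->
  poly_eval c x = \sum_(i < n) iota c`_i * x ^+ i.
Proof.
move=> cn; rewrite /poly_eval (@horner_coef_wide _ n) ?size_map_poly //.
by apply: eq_bigr => i _; rewrite coef_map.
Qed.

(** Frobenius is a ring morphism of G fixing the coefficients, which lie in F_p. *)
Lemma poly_evalXp c x : poly_eval c (x ^+ p) = poly_eval c x ^+ p.
Proof.
rewrite /poly_eval -[x ^+ p]/(pFrobenius_aut pcharG x).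
rewrite -[RHS]/(pFrobenius_aut pcharG _) -horner_map -map_poly_comp.
congr (_.[_]); apply: eq_map_poly => a /=.
by rewrite pFrobenius_aut_nat.
Qed.

Lemma poly_eval_Frobenius c x l :
  (poly_eval c (x ^+ (p ^ l)) == 0) = (poly_eval c x == 0).
Proof.
elim: l => [|l IHl]; first by rewrite expr1.
by rewrite expnSr exprM poly_evalXp expf_eq0 prime_gt0 //= IHl.
Qed.

Lemma incl_sum (I : finType) (f : I -> 'F_p) :
  \sum_i iota (f i) = iota (\sum_i f i).
Proof. by rewrite rmorph_sum. Qed.

Lemma incl_eq0 a : (iota a == 0) = (a == 0).
Proof. exact: fmorph_eq0. Qed.

End Evaluation.

(** * Cyclic codes, extended words and their power moments *)

Section CyclicCodes.

Variables (p m : nat) (G : finFieldType) (beta : G).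
Hypothesis p_prime : prime p.
Hypothesis cardG : #|G| = (p ^ m)%N.
Local Notation n := (p ^ m - 1)%N.
Hypothesis beta_prim : n.-primitive_root beta.
Hypothesis n_gt1 : (1 < n)%N.

Local Notation iota := (@prime_field_incl p G).
Local Notation ev := (@poly_eval p G).
Local Notation ideal := (@generated_ideal p n).
Local Notation qring := {poly %/ ('X^n - 1 : {poly 'F_p})}.

Let pcharG : p \in [pchar G] := card_finPcharP cardG p_prime.
Let n_gt0 : (0 < n)%N := ltnW n_gt1.

Lemma card_labels : #|G| = n.+1.
Proof. by rewrite cardG subn1 prednK // expn_gt0 prime_gt0. Qed.

Lemma label_neq0 i : beta ^+ i != 0.
Proof.
rewrite expf_neq0 //; apply/eqP => b0; have := prim_expr_order beta_prim.
by rewrite b0 expr0n gtn_eqF // => /eqP; rewrite eq_sym oner_eq0.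
Qed.

Lemma label_inj : injective (fun i : 'I_n => beta ^+ i).
Proof.
move=> i j /eqP; rewrite (eq_prim_root_expr beta_prim) !modn_small // => /eqP.
exact: val_inj.
Qed.

Lemma labels_image : [set beta ^+ i | i : 'I_n] = [set X | X != 0].
Proof.
apply/eqP; rewrite eqEcard; apply/andP; split.
  by apply/fintype.subsetP => _ /imsetP[i _ ->]; rewrite inE label_neq0.
rewrite card_imset ?card_ord; last exact: label_inj.
have <- : #|predC1 (0 : G)| = n by rewrite cardC1 card_labels.
by apply: subset_leq_card; apply/fintype.subsetP => X; rewrite !inE.
Qed.

Lemma labelP X : X != 0 -> exists i : 'I_n, X = beta ^+ i.
Proof.
move=> X0; have : X \in [set X | X != 0] by rewrite inE.
by rewrite -labels_image => /imsetP[i _ ->]; exists i.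
Qed.

Lemma sum_labels (M : nmodType) (f : G -> M) :
  \sum_X f X = f 0 + \sum_(i < n) f (beta ^+ i).
Proof.
rewrite (bigD1 0) //=; congr (_ + _).
rewrite (eq_bigl (mem [set X | X != 0])) => [|X]; last by rewrite !inE.
rewrite -labels_image big_imset //=; last by move=> i j _ _; apply: label_inj.
Qed.

(** The quotient ring is taken modulo [mk_monic], which substitutes a default unless its argument is
    monic and nonconstant. *)
Lemma mk_monicE : mk_monic ('X^n - 1 : {poly 'F_p}) = 'X^n - 1.
Proof.
rewrite /mk_monic size_XnsubC // ltnS n_gt0 /=.
by rewrite -[1]/(1%:P) monicXnsubC.
Qed.

Lemma size_qring (c : qring) : (size c <= n)%N.
Proof.
rewrite -ltnS -(size_XnsubC (1 : 'F_p) n_gt0) -[in X in (_ < X)%N]mk_monicE.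
exact: size_mk_monic.
Qed.

Lemma eval_in_qpoly q k :
  ev (in_qpoly ('X^n - 1) q) (beta ^+ k) = ev q (beta ^+ k).
Proof.
have qE := Pdiv.RingMonic.rdivp_eq (monic_mk_monic ('X^n - 1 : {poly 'F_p})) q.
have h0 : ev (mk_monic ('X^n - 1)) (beta ^+ k) = 0.
  rewrite mk_monicE /poly_eval (map_Xn_sub1 pcharG) !hornerE.
  by rewrite -exprM mulnC exprM (prim_expr_order beta_prim) expr1n subrr.
by rewrite [in RHS]qE (poly_evalD pcharG) (poly_evalM pcharG) h0 mulr0 add0r.
Qed.

Lemma eval_generated_ideal g (c : qring) k : ideal g c ->
  ev g (beta ^+ k) = 0 -> ev c (beta ^+ k) = 0.
Proof.
move=> [h ->] gk.
rewrite -[X in ev X]/(polyn (in_qpoly ('X^n - 1) ((h : {poly 'F_p}) * in_qpoly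
  ('X^n - 1) g))).
by rewrite eval_in_qpoly (poly_evalM pcharG) eval_in_qpoly gk mulr0.
Qed.

Lemma generated_ideal_gen g : ideal g (in_qpoly ('X^n - 1) g).
Proof. by exists 1; rewrite mul1r. Qed.

(** Over G, X^n - 1 is a product of distinct factors X - beta^k, and g is up to a unit a subproduct;
    vanishing at the zeros of g therefore means divisibility by g, which descends to F_p. *)
Lemma mem_generated_ideal g (c : {poly 'F_p}) : g %| 'X^n - 1 ->
    (forall k, (k < n)%N -> ev g (beta ^+ k) = 0 -> ev c (beta ^+ k) = 0) ->
  ideal g (in_qpoly ('X^n - 1) c).
Proof.
move=> g_dvd gc.
suff /dvdpP[q ->] : g %| c by exists (in_qpoly ('X^n - 1) q); rewrite rmorphM.
rewrite -(dvdp_map_incl pcharG).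
have := g_dvd; rewrite -(dvdp_map_incl pcharG) (map_Xn_sub1 pcharG)
  -(factor_Xn_sub_1 beta_prim).
case/dvdp_prod_XsubC => b; rewrite -(big_map (fun i => beta ^+ i) xpredT (fun z
  => 'X - z%:P)).
set rs := map _ _ => g_eq.
have rsP z : z \in rs -> exists2 k, (k < n)%N & z = beta ^+ k.
  by case/mapP => k /mem_mask; rewrite mem_index_iota => /andP[_ kn] ->;
    exists k.
rewrite (eqp_dvdl _ g_eq) uniq_roots_dvdp //.
  apply/allP => z z_rs; have [k kn zE] := rsP z z_rs.
  rewrite zE; apply/rootP/gc => //; apply/rootP.
  by rewrite (eqp_root g_eq) root_prod_XsubC -zE.
rewrite uniq_rootsE map_inj_in_uniq ?mask_uniq ?iota_uniq // => i j.
move=> /mem_mask + /mem_mask; rewrite !mem_index_iota => /andP[_ i_lt] /andP[_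
  j_lt] ij.
by have /(congr1 val) := @label_inj (Ordinal i_lt) (Ordinal j_lt) ij.
Qed.

(** The sum over i with beta^i = X has one term; it stands for the discrete logarithm of X. *)
Definition word_of (c : {poly 'F_p}) : {ffun G -> 'F_p} :=
  [ffun X => if X == 0 then - \sum_(i < n) c`_i
             else \sum_(i < n | beta ^+ i == X) c`_i].

Lemma word_of0 c : word_of c 0 = - \sum_(i < n) c`_i.
Proof. by rewrite ffunE eqxx. Qed.

Lemma word_of_label c (i : 'I_n) : word_of c (beta ^+ i) = c`_i.
Proof.
rewrite ffunE (negPf (label_neq0 i)) (bigD1 i) //= big1 ?addr0 // => j
  /andP[/eqP ij].
by rewrite (label_inj ij) eqxx.
Qed.

Lemma extended_codeP C (v : {ffun G -> 'F_p}) :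
  extended_code beta C v <-> exists2 c : qring, C c & v = word_of c.
Proof.
split=> [[c [Cc v0 vE]]|[c Cc ->]]; exists c => //.
  apply/ffunP => X; have [->|/labelP[i ->]] := eqVneq X 0;
    first by rewrite word_of0.
  by rewrite word_of_label.
by split=> // [|i]; rewrite ?word_of0 ?word_of_label.
Qed.

Lemma sum_word_of c : \sum_X word_of c X = 0.
Proof.
rewrite sum_labels word_of0 [X in _ + X](eq_bigr (fun i : 'I_n => c`_i)) ?addNr
  // => i _.
exact: word_of_label.
Qed.

(** Zeros of a codeword polynomial become vanishing power moments of the extended word; k > 0
    removes the term at label 0. *)
Lemma moment_word_of (c : {poly 'F_p}) k : (size c <= n)%N -> (0 < k)%N ->
  \sum_X iota (word_of c X) * X ^+ k = ev c (beta ^+ k).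
Proof.
move=> cn k0; rewrite sum_labels expr0n gtn_eqF // mulr0 add0r (poly_eval_wide
  pcharG _ cn).
by apply: eq_bigr => i _; rewrite word_of_label -!exprM mulnC.
Qed.

Lemma eval_cyclotomic c i j : cyclotomic_class p n j i ->
  (ev c (beta ^+ i) == 0) = (ev c (beta ^+ j) == 0).
Proof.
have expE a b : a = b %[mod n] -> beta ^+ a = beta ^+ b.
  by move=> /eqP ab; apply/eqP; rewrite (eq_prim_root_expr beta_prim).
by move=> [_ [l [/expE|/expE]]] E; [rewrite E|rewrite -E];
  rewrite exprM (poly_eval_Frobenius pcharG).
Qed.

(** Reindexing turns the hypothesis into the vanishing of the sum of f(X) (X - b)^u, a polynomial in
    b of degree at most u with more than u roots; all its coefficients are therefore 0. *)
Lemma first_moment (f : G -> G) u : (0 < u)%N -> (u < n)%N -> coprime u p ->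
  (forall b, \sum_X f (X + b) * X ^+ u = 0) -> \sum_X f X * X = 0.
Proof.
case: u => // u _ un u_p fu.
pose Q : {poly G} := \poly_(i < u.+2)
  ((-1) ^+ i *+ 'C(u.+1, i) * \sum_X f X * X ^+ (u.+1 - i)).
have Q0 : Q = 0.
  apply: (@roots_geq_poly_eq0 _ _ (enum G)); last 1 first.
  - by rewrite (leq_trans (size_poly _ _)) // -cardE card_labels ltnS ltnW.
  - apply/allP => b _; apply/rootP; rewrite horner_poly -[RHS](fu b).
    rewrite (reindex_inj (addIr (- b))) /=.
    under [RHS]eq_bigr => X _ do rewrite subrK exprBn mulr_sumr.
    rewrite exchange_big; apply: eq_bigr => i _ /=.
    rewrite mulr_sumr mulr_suml; apply: eq_bigr => X _.
    rewrite !mulrnAl mulrnAr; congr (_ *+ _).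
    by ring.
  - exact: enum_uniq.
(* The exponent is now u + 1, so this coefficient is, up to sign, (u + 1) times the first moment,
   and u + 1 is prime to p. *)
have /eqP : Q`_u = 0 by rewrite Q0 coef0.
rewrite coef_poly leqnSn binSn subSnn mulf_eq0 => /orP[|/eqP fX]; last first.
  by rewrite -[RHS]fX; apply: eq_bigr => X _; rewrite expr1.
rewrite -mulr_natr mulf_eq0 signr_eq0 /= -(dvdn_pcharf pcharG) => p_dvd.
by move: u_p; rewrite coprime_sym prime_coprime // p_dvd.
Qed.

(** The first moment is written with the multiples [X *+ v X] because additive bijections of G
    preserve this form. *)
Theorem extended_maximal_affine_invariantP (A : set {ffun G -> 'F_p}) :
    extended_maximal_affine_invariant n beta A -> (exists2 v, A v & v != 0) ->
  forall v, A v <-> \sum_X v X = 0 /\ \sum_X X *+ v X = 0.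
Proof.
move=> [A_inv [C [g [g_dvd CE [j jn gj]]] AE]] [w Aw w0].
have {}AE v : A v <-> exists2 c : qring, ideal g c & v = word_of c.
  by rewrite AE extended_codeP CE.
have gP i : (i < n)%N -> (ev g (beta ^+ i) = 0 <-> cyclotomic_class p n j i).
  by move=> i_lt; rewrite -gj; split=> [|[]].
have momentE (v : {ffun G -> 'F_p}) : \sum_X X *+ v X = \sum_X iota (v X) * X
  ^+ 1.
  by apply: eq_bigr => X _; rewrite expr1 mulr_natl.
have gj0 : ev g (beta ^+ j) = 0.
  by apply/gP => //; split=> //; exists 0%N; left; rewrite muln1.
have A_moment (v : {ffun G -> 'F_p}) k : A v -> (0 < k)%N -> ev g (beta ^+ k) =
  0 ->
    \sum_X iota (v X) * X ^+ k = 0.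
  move=> /AE[c Cc ->] k0 gk; rewrite moment_word_of ?size_qring //.
  exact: eval_generated_ideal Cc gk.
(* If j were 0, every codeword would have coefficient sum 0, hence value 0 at label 0; translating
   [w] by b would give w(b) = 0 for all b. *)
have j0 : (0 < j)%N.
  rewrite lt0n; apply: contraNneq w0 => j0; apply/eqP/ffunP => b; rewrite ffunE.
  have /AE[c Cc vE] : A [ffun X => w (1 * X + b)] by apply/A_inv;
    rewrite ?oner_neq0.
  move/ffunP/(_ 0): vE; rewrite ffunE mulr0 add0r word_of0 => ->.
  have := eval_generated_ideal Cc gj0; rewrite j0 expr0.
  rewrite (poly_eval_wide pcharG _ (size_qring c)).
  under eq_bigr do rewrite expr1n mulr1.
  by rewrite (incl_sum pcharG) => /eqP; rewrite (incl_eq0 pcharG) => /eqP ->;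
    rewrite oppr0.
have g1 : ev g (beta ^+ 1) = 0.
  (* Frobenius allows the p-part of j to be removed, leaving a zero exponent prime to p. *)
  pose u := (j`_(p^'))%N.
  have jE : (u * p ^ logn p j)%N = j by rewrite -p_part mulnC partnC.
  have gu : ev g (beta ^+ u) = 0.
    by apply/eqP; rewrite -(poly_eval_Frobenius pcharG g _ (logn p j)) -exprM
      jE gj0.
  have Ag : A (word_of (in_qpoly ('X^n - 1) g)).
    by apply/AE; exists (in_qpoly ('X^n - 1) g) => //;
      apply: generated_ideal_gen.
  (* The value of g at beta is the first moment of the word of g itself, a member of [A]. *)
  rewrite -eval_in_qpoly -moment_word_of ?size_qring //.
  under eq_bigr do rewrite expr1.
  apply: (@first_moment _ u); rewrite ?part_gt0 //.
  - by apply: leq_ltn_trans jn; rewrite -jE leq_pmulr // expn_gt0 prime_gt0.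
  - by rewrite coprime_sym prime_coprime // -p'natE // part_pnat.
  move=> b; rewrite -[RHS](A_moment [ffun X => word_of (in_qpoly ('X^n - 1) g)
    (1 * X + b)] u) ?part_gt0 //.
    by apply: eq_bigr => X _; rewrite [in RHS]ffunE mul1r.
  by apply/A_inv; rewrite ?oner_neq0.
have cl1 : cyclotomic_class p n j 1 by apply/gP.
move=> v; split=> [Av|[v0 v1]].
  split; first by have /AE[c _ ->] := Av; exact: sum_word_of.
  by rewrite momentE A_moment.
(* Conversely, v is read as a polynomial: its first moment makes beta a zero, hence so is every
   beta^k with k in the class of j, and c lies in the ideal. *)
pose c : {poly 'F_p} := \poly_(i < n) v (beta ^+ i).
have cn : (size c <= n)%N by apply: size_poly.
have vE : v = word_of c.
  apply/ffunP => X; have [->|/labelP[i ->]] := eqVneq X 0; last first.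
    by rewrite word_of_label coef_poly ltn_ord.
  rewrite word_of0; move/eqP: v0; rewrite sum_labels addr_eq0 => /eqP->;
    congr (- _).
  by apply: eq_bigr => i _; rewrite coef_poly ltn_ord.
have c1 : ev c (beta ^+ 1) = 0 by rewrite -moment_word_of // -vE -momentE.
apply/AE; exists (in_qpoly ('X^n - 1) c); last first.
  by rewrite in_qpoly_small // mk_monicE size_XnsubC.
apply: mem_generated_ideal => // k kn /(gP _ kn) clk; apply/eqP.
by rewrite (eval_cyclotomic _ clk) -(eval_cyclotomic _ cl1) c1.
Qed.

End CyclicCodes.

(** * The numerical bound and the assembly of the quantum code *)

(** The right side is (p - 1) p^(m-1). For p = 2 the nonzero dimension excludes m = 3, so m >= 4;
    for p = 3, m >= 3; for p >= 5 the factor p - 1 >= 4 is enough. *)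
Lemma light_word_bound p m : prime p -> (0 < m)%N -> (3 < p)%N \/ (2 < m)%N ->
  (p ^ m - 2 - 2 * m != 0)%N -> (m + 2 < p ^ m - p ^ m.-1)%N.
Proof.
move=> p_prime; case: m => // k _ pm K0 /=.
have p_gt1 := prime_gt1 p_prime.
have -> : (p ^ k.+1 - p ^ k = p.-1 * p ^ k)%N by rewrite expnS -{2}[(p ^
  k)%N]mul1n -mulnBl subn1.
have pk : (k < p ^ k)%N by apply: ltn_expl.
have [p2|p_neq2] := eqVneq p 2%N.
  rewrite p2 /= mul1n in K0 *.
  have k3 : (3 <= k)%N by move: K0 pm; rewrite p2;
    case: k {pk} => [|[|[|]]] //= _ []; lia.
  rewrite -(subnK k3) expnD; have := ltn_expl (k - 3) (isT : 1 < 2)%N; lia.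
have [p3|p_neq3] := eqVneq p 3%N.
  by case: pm; [rewrite p3 | move=> k2; rewrite p3 /=; rewrite p3 in pk; nia].
have p5 : (5 <= p)%N.
  by move: p_prime p_gt1 p_neq2 p_neq3; case: p {pm K0 pk} => [|[|[|[|[|]]]]].
by have : (4 * p ^ k <= p.-1 * p ^ k)%N; [rewrite leq_mul2r; apply/orP; right;
  lia | lia].
Qed.

(* The subtractions p ^ m - 1 and p ^ m - 2 - 2 * m are not truncated under the
   hypotheses, the second being 0 exactly when p = 2 and m = 3. *)
Theorem corollary7 (R : realType) (p m : nat)
    (hp : prime p) (hm : (0 < m)%N) (hpm : (3 < p)%N \/ (2 < m)%N)
    (G : finFieldType) (hG : #|G| = (p ^ m)%N)
    (beta : G) (hbeta : (p ^ m - 1)%N.-primitive_root beta)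
    (A : set {ffun G -> 'F_p})
    (hA : @extended_maximal_affine_invariant p (p ^ m - 1) G beta A)
    (dA : nat) (hdA : min_distance A dA) :
  exists (dQ : nat) (V : {vspace qudit_space R p (p ^ m)})
         (P : 'End(qudit_space R p (p ^ m))),
    [/\ quantum_code V P (p ^ m - 2 - 2 * m) dQ,
        pure_code P dQ,
        (dQ <= m + 2)%N
      & dQ = dA].
Proof.
have [e e_bij eD] := Fp_coordinates hp hG.
pose phi (k : 'I_(p ^ m)) : G := enum_val (cast_ord (esym hG) k).
have phi_bij : bijective phi.
  apply: inj_card_bij => [k l /enum_val_inj/cast_ord_inj //|].
  by rewrite card_ord hG.
pose E k := e (phi k).
have E_bij : bijective E by exact: bij_comp e_bij phi_bij.
pose B := affine_code E.
have B0 : 0 \in B by exact: affine_code0.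
have BB : {in B &, forall x y, x - y \in B} by exact: affine_codeB.
have B_dual : {subset B <= dual B} by exact: affine_code_dual.
have cardB : #|B| = (p ^ m.+1)%N by exact: card_affine_code.
pose pull (v : {ffun G -> 'F_p}) : {ffun 'I_(p ^ m) -> 'F_p} := [ffun k => v
  (phi k)].
have [psi phiK psiK] := phi_bij.
have pull_surj w : exists v, pull v = w.
  by exists [ffun X => w (psi X)]; apply/ffunP => k; rewrite !ffunE phiK.
have weight_pull u v : weight (pull u - pull v) = hamming_dist u v.
  rewrite /hamming_dist -(on_card_preimset (onW_bij _ phi_bij)).
  by apply: eq_card => k; rewrite !inE !ffunE subr_eq0.
have [[u0 [v0 [Au Av uv_neq uv_dist]]] A_min] := hdA.
have n_gt1 : (1 < p ^ m - 1)%N.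
  have p2 := prime_gt1 hp; have pm_lt := ltn_expl m p2.
  case: hpm => [p3|m2]; last by lia.
  by have : (p ^ 1 <= p ^ m)%N; [rewrite leq_exp2l | rewrite expn1; lia].
have A_neq0 : exists2 v, A v & v != 0.
  have [u00|] := eqVneq u0 0; last by exists u0.
  by exists v0 => //; rewrite eq_sym -u00.
have e0 : e 0 = 0 by apply: (addrI (e 0)); rewrite -eD !addr0.
have eMn x k : e (x *+ k) = e x *+ k.
  by elim: k => [|k IHk]; rewrite ?mulr0n // !mulrS eD IHk.
have e_sum (f : 'I_(p ^ m) -> G) : e (\sum_k f k) = \sum_k e (f k) by exact:
  big_morph.
(* As [e] is additive, the sum and the m coordinates of the first moment become the m + 1 equations
   of the dual of [B]. *)
have A_dual v : A v <-> pull v \in dual B.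
  rewrite (extended_maximal_affine_invariantP hp hG hbeta n_gt1 hA A_neq0).
  have sumE : \sum_X v X = \sum_k pull v k.
    rewrite (reindex phi) /=; last exact: onW_bij.
    by apply: eq_bigr => k _; rewrite ffunE.
  have momentE i : e (\sum_X X *+ v X) i = \sum_k pull v k * E k i.
    rewrite (reindex phi) /=; last exact: onW_bij.
    rewrite e_sum sum_ffunE; apply: eq_bigr => k _.
    rewrite eMn ffunMnE [pull v k]ffunE -mulr_natl. by rewrite natr_Zp.
  split=> [[sum0 sum1]|/dual_affine_codeP[sum0 sum1]].
    by apply/dual_affine_codeP; split=> [|i]; rewrite -?sumE -?momentE // sum1
      e0 ffunE.
  split; first by rewrite sumE.
  apply: (bij_inj e_bij); rewrite e0; apply/ffunP => i.
  by rewrite momentE sum1 ffunE.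
have A0 : A 0 by apply/A_dual; have -> : pull 0 = 0; [apply/ffunP => k;
  rewrite !ffunE | apply: B_dual].
have dual_weight x : x \in dual B -> x != 0 -> (dA <= weight x)%N.
  have [v <-] := pull_surj x => vB x0.
  rewrite -[pull v]subr0.
  have pull0 : pull 0 = 0 by apply/ffunP => k; rewrite !ffunE.
  rewrite -pull0 weight_pull A_min //; first exact/A_dual.
  by apply: contraNneq x0 => ->; rewrite pull0.
(* The dual is additive, so a pair at minimum distance gives a word of weight [dA]. *)
pose w := pull u0 - pull v0.
have w_dual : w \in dual B by apply: dualB; apply/A_dual.
have w_weight : weight w = dA by rewrite weight_pull.
have w0 : w != 0.
  rewrite -weight_gt0 weight_pull; apply/card_gt0P; apply/existsP.
  by apply: contraNT uv_neq => /existsPn uv; apply/eqP/ffunP => X;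
    apply/eqP/negPn/uv.
have dA_le : (dA <= m + 2)%N.
  have [v vB [v_neq0 v_weight]] := dual_light_word hp E_bij hm hpm.
  exact: leq_trans (dual_weight v vB v_neq0) v_weight.
have dimE : (p ^ m - 2 - 2 * m = p ^ m - 2 * m.+1)%N by lia.
exists dA, (limg (css_proj R B)), (css_proj R B); split=> //;
  last exact: css_pure.
rewrite dimE; apply: (css_quantum_code R hp B0 BB B_dual dual_weight cardB
  w_dual w0 w_weight).
(* In positive dimension [w] is too light to be a nonzero affine function. *)
rewrite -dimE => /(light_word_bound hp hm hpm); rewrite ltnNge;
  apply: contraNN => wB.
by apply: leq_trans dA_le; rewrite -w_weight; exact: (weight_affine_code hp
  E_bij hm wB w0).
Qed.
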